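(* Let $X$ be a Urysohn space. Then $|X|\leq \pi\chi(X)^{Uc(X)\,\psi_{\theta}(X)}$.
   Context: A space $X$ is Urysohn if for every two distinct points $x,y\in X$ there are open sets $U\ni x$ and $V\ni y$ with $\overline{U}\cap\overline{V}=\emptyset$. For $A\subseteq X$, the $\theta$-closure is $cl_{\theta}(A)=\{x\in X:\ \overline{U}\cap A\neq\emptyset \text{ for every open neighborhood } U \text{ of } x\}$. $\pi\chi(X)$ is the $\pi$-character of $X$ (the supremum over $p\in X$ of the least size of a local $\pi$-base at $p$; a local $\pi$-base at $p$ is a family of nonempty open sets such that every neighborhood of $p$ contains a member of the family). A collection $\mathcal{V}$ of (nonempty) open subsets of $X$ is Urysohn-cellular if $O_1,O_2\in\mathcal{V}$ and $O_1\neq O_2$ imply $\overline{O_1}\cap\overline{O_2}=\emptyset$. The Urysohn-cellularity is $Uc(X)=\sup\{|\mathcal{V}|:\mathcal{V}\text{ is Urysohn-cellular}\}$. For a Urysohn space $X$ and $x\in X$, the $\theta$-pseudocharacter $\psi_{\theta}(x,X)$ is the smallest cardinal $\kappa$ for which there is a family $\mathcal{U}$ of open neighborhoods of $x$ with $|\mathcal{U}|\leq\kappa$ and $\{x\}=\bigcap\{cl_{\theta}(\overline{U}):U\in\mathcal{U}\}$; and $\psi_{\theta}(X)=\sup\{\psi_{\theta}(x,X):x\in X\}$. Convention: the cardinal functions $\pi\chi$, $Uc$, $\psi_\theta$ are taken to be infinite-valued (i.e. $\aleph_0$ is added: $\pi\chi(X)$ stands for $\aleph_0$ plus the supremum over $p\in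 X$ of the least size of a local $\pi$-base at $p$, $Uc(X)$ stands for $\aleph_0+\sup\{|\mathcal{V}|:\mathcal{V}\text{ is Urysohn-cellular}\}$, and $\psi_{\theta}(X)$ stands for $\aleph_0+\sup\{\psi_{\theta}(x,X):x\in X\}$). *)

(* Defs.v *)
From mathcomp Require Import all_boot all_order.
From mathcomp Require Import all_classical.
From mathcomp Require Import topology.

Set Implicit Arguments.
Unset Strict Implicit.
Unset Printing Implicit Defensive.

Local Open Scope classical_set_scope.
Local Open Scope card_scope.

(* A cardinal number is represented by any type having that many elements, and
   cardinals are compared by the existence of an injection, i.e. by #<= between
   the full sets.  The sum, product and power of cardinals are thus K + L,
   K * L and L -> K (for K to the power L), and aleph_0 is nat. *)

Definition is_least_card (P : Type -> Prop) (K : Type) : Prop :=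
  P K /\ forall L, P L -> [set: K] #<= [set: L].

Definition least_card (P : Type -> Prop) : Type :=
  if pselect (exists K, is_least_card P K) is left ex then projT1 (cid ex)
  else void.

(* The supremum of a family of cardinals is its least upper bound. *)
Definition card_sup (I : Type) (F : I -> Type) : Type :=
  least_card (fun K => forall i, [set: F i] #<= [set: K]).

Lemma card_le_typeP (K L : Type) :
  [set: K] #<= [set: L] <-> exists f : K -> L, injective f.
Proof.
split=> [KL|[f finj]].
  have /card_leP[g] := KL; have inT T (x : T) : x \in [set: T] by rewrite inE.
  exists (fun x => sval (g (SigSub (inT _ x)))) => x1 x2 /val_inj eg.
  have /(congr1 sval) // : SigSub (inT _ x1) = SigSub (inT _ x2).
  by apply: ('inj_g) eg; rewrite inE.
have /injfunPex[i] : exists2 f : K -> L, set_fun setT setT f & set_inj setT f.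
  by exists f => // x y _ _; exact: finj.
exact: inj_card_le i.
Qed.

(* Cardinals are well ordered, so [least_card P] takes its default value [void]
   only when no cardinal satisfies P.  For a family, a maximal set of pairwise
   everywhere-different elements of the product of its members surjects onto
   one of them and injects into all of them. *)
Lemma card_least_family (I : Type) (F : I -> Type) (i0 : I) :
  exists i, forall j, [set: F i] #<= [set: F j].
Proof.
pose P (Y : set (forall i, F i)) :=
  forall f g i, Y f -> Y g -> f i = g i -> f = g.
have [Ys YsP totY|Y [PY maxY]] := @Zorn_bigcup _ P.
  move=> f g i [A YsA Af] [B YsB Bg].
  have [AB|BA] := totY _ _ YsA YsB.
    exact: YsP YsB _ _ _ (AB _ Af) Bg.
  exact: YsP YsA _ _ _ Af (BA _ Bg).
have [[i isurj]|/forallNP nsurj] :=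
    pselect (exists i, forall x : F i, exists2 f, Y f & f i = x).
  exists i => j; apply/card_le_typeP.
  have /choice[h hP] : forall x : F i, exists f, Y f /\ f i = x.
    by move=> x; have [f] := isurj x; exists f.
  exists (fun x => h x j) => x y exy.
  have [Yx <-] := hP x; have [Yy <-] := hP y.
  by rewrite (PY _ _ _ Yx Yy exy).
have fresh i : {x : F i | forall f, Y f -> f i <> x}.
  apply: cid; have /existsNP[x xP] := nsurj i.
  by exists x => f Yf fx; apply: xP; exists f.
pose f i := sval (fresh i).
have fP g i : Y g -> g i <> f i by exact: svalP (fresh i) g.
case: (maxY (Y `|` [set f])).
  rewrite properEneq; split; last exact: subsetUl.
  apply/eqP => YE; have Yf : Y f by rewrite YE; right.
  exact: fP f i0 Yf erefl.
move=> g h i [Yg|->] [Yh|->] //; first exact: PY.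
  by move=> /fP; case.
by move=> /esym /fP; case.
Qed.

Lemma is_least_card_exists (P : Type -> Prop) :
  (exists K, P K) -> exists K, is_least_card P K.
Proof.
move=> [K0 PK0].
have card_tot (K L : Type) : [set: K] #<= [set: L] \/ [set: L] #<= [set: K].
  have [[] le] := card_least_family (fun b : bool => if b then K else L) true.
    by left; exact: le false.
  by right; exact: le true.
pose J := {A : set K0 | exists2 L, P L & [set: A] #= [set: L]}.
have jP : exists2 L, P L & [set: [set: K0]] #= [set: L].
  by exists K0.
have [[A [L PL AL]] Amin] :=
  card_least_family (fun j : J => set_type (sval j)) (exist _ [set: K0] jP).
exists L; split=> // M PM; have LA : [set: L] #<= [set: A].
  by have /andP[] : _ && _ := etrans (esym (card_eq_le _ _)) AL.
have AK : [set: A] #<= [set: K0].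
  by rewrite (card_le_eql (card_setT _)); exact: card_leT.
have [MK|KM] := card_tot M K0; last first.
  exact: card_le_trans LA (card_le_trans AK KM).
have /card_le_typeP[f finj] := MK.
have rP : exists2 L, P L & [set: range f] #= [set: L].
  exists M => //; rewrite (card_eql (card_setT _)).
  by apply: inj_card_eq => x y _ _; exact: finj.
apply: card_le_trans LA (card_le_trans (Amin (exist _ _ rP)) _) => /=.
by rewrite (card_le_eql (card_setT _)); exact: card_image_le.
Qed.

Lemma least_cardP (P : Type -> Prop) :
  (exists K, P K) -> is_least_card P (least_card P).
Proof.
rewrite /least_card => /is_least_card_exists exP.
by case: pselect => // ex; exact: projT2 (cid ex).
Qed.

Lemma card_supP (I : Type) (F : I -> Type) :
  is_least_card (fun K => forall i, [set: F i] #<= [set: K]) (card_sup F).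
Proof.
apply: least_cardP; exists {i : I & F i} => i.
apply/card_le_typeP; exists (existT F i) => x y.
exact: (@existT_inj2 {classic I}).
Qed.

Section spaces.
Variable X : topologicalType.

Definition urysohn_space : Prop :=
  forall x y : X, x <> y -> exists U V : set X,
    [/\ open U, U x, open V, V y & closure U `&` closure V = set0].

Definition theta_closure (A : set X) : set X :=
  [set x | forall U, open U -> U x -> closure U `&` A !=set0].

Definition local_pi_base (p : X) (B : set (set X)) : Prop :=
  (forall O, B O -> open O /\ O !=set0) /\
  (forall U, nbhs p U -> exists2 O, B O & O `<=` U).

Definition local_pi_character (p : X) : Type :=
  least_card (fun K => exists2 B, local_pi_base p B & B #= [set: K]).

Lemma local_pi_characterP (p : X) :
  is_least_card (fun K => exists2 B, local_pi_base p B & B #= [set: K])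
    (local_pi_character p).
Proof.
apply: least_cardP.
pose B := [set O : set X | open O /\ O !=set0].
exists B; exists B; last exact: card_setT_sym.
split=> // U; rewrite nbhsE => -[O [Oo Op] OU].
by exists O => //; split=> //; exists p.
Qed.

Definition pi_character : Type := nat + card_sup local_pi_character.

Definition urysohn_cellular (V : set (set X)) : Prop :=
  (forall O, V O -> open O /\ O !=set0) /\
  (forall O1 O2, V O1 -> V O2 -> O1 <> O2 ->
    closure O1 `&` closure O2 = set0).

Definition urysohn_cellularity : Type :=
  nat + card_sup (fun V : {V | urysohn_cellular V} => set_type (sval V)).

Definition local_theta_pseudocharacter (x : X) : Type :=
  least_card (fun K => exists Us : set (set X),
    [/\ forall U, Us U -> open U /\ U x, Us #<= [set: K] &
        [set x] = \bigcap_(U in Us) theta_closure (closure U)]).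

Lemma local_theta_pseudocharacterP (x : X) : urysohn_space ->
  is_least_card (fun K => exists Us : set (set X),
    [/\ forall U, Us U -> open U /\ U x, Us #<= [set: K] &
        [set x] = \bigcap_(U in Us) theta_closure (closure U)])
    (local_theta_pseudocharacter x).
Proof.
move=> uX; apply: least_cardP.
pose Us := [set U : set X | open U /\ U x].
exists Us; exists Us; split=> //.
  by have /andP[] : _ && _ := etrans (esym (card_eq_le _ _)) (card_setT_sym Us).
apply/seteqP; split=> [_ -> U [_ Ux] V _ Vx|y yP].
  by exists x; split; exact: subset_closure.
apply: contrapT => yx; have [V [U [oV Vy oU Ux VU0]]] := uX _ _ yx.
by have := yP U (conj oU Ux) V oV Vy; rewrite VU0 => -[].
Qed.

Definition theta_pseudocharacter : Type :=
  nat + card_sup local_theta_pseudocharacter.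

End spaces.

(* Main.v *)
Require Import Defs.
From mathcomp Require Import all_boot all_order.
From mathcomp Require Import all_classical.
From mathcomp Require Import topology.

Set Implicit Arguments.
Unset Strict Implicit.
Unset Printing Implicit Defensive.

(** Let P = pi chi(X) and let D be the product Uc(X) psi_theta(X); both are
    infinite.  Fix at each point x a local pi-base B x of at most P sets.

    Given a family c of points and a choice of at most one member of B (c (d, e))
    for each pair (d, e) in D * D, let W_d be the union over e of the closures of
    the chosen sets, and let Phi be the union over d of the theta-closures of the
    W_d.  Each choice pattern thus gives an operation sending c to a point
    outside Phi, if there is one.  Let A be the closure of a single point under
    these operations.  There are P ^ D patterns, and A consists of the values of
    well-founded terms.  A term is determined by its labels along finite paths,
    hence A has at most P ^ D elements ([closing_off], [card_closing_off]).  The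
    arithmetic needed here follows from the fact that seq K injects into K for
    every infinite K ([card_seq_le]).

    It remains to see that A is all of X.  Suppose that q is not in A, and let
    Us be a family of at most D neighborhoods of q that realizes the
    theta-pseudocharacter at q.  For U in Us, choose a maximal Urysohn-cellular
    family V U of members of the families B a, a in A, whose closures miss that
    of U, and let W be the union of the closures of the members of V U.  By
    maximality, the theta-closure of W contains every point of A outside the
    theta-closure of the closure of U ([urysohn_cellular_theta_cover]); it does
    not contain q, because the closure of U is disjoint from W.  Every a in A is
    outside one of these theta-closures, since only q is in all of them.  So the
    set Phi built from the families V U contains A and misses q, and the
    corresponding operation produces a point of A outside Phi, a
    contradiction. *)

Local Open Scope classical_set_scope.
Local Open Scope card_scope.

(** * Arithmetic of infinite cardinals *)

Lemma card_le_total (K L : Type) :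
  [set: K] #<= [set: L] \/ [set: L] #<= [set: K].
Proof.
have [[] le] :=
  card_least_family (I := bool) (fun b => if b then K else L) true.
  by left; exact: le false.
by right; exact: le true.
Qed.

Lemma card_le_set_inj (T : Type) (A B : set T) : [set: A] #<= [set: B] ->
  exists h : T -> T, (forall x, A x -> B (h x)) /\
    (forall x y, A x -> A y -> h x = h y -> x = y).
Proof.
move=> /card_le_typeP[f finj].
pose h x :=
  if pselect (A x) is left Ax then val (f (SigSub (mem_set Ax))) else x.
exists h; split=> [x Ax|x y Ax Ay]; rewrite /h; case: pselect => // Ax'.
  exact/set_mem/valP.
by case: pselect => // Ay' /val_inj /finj [].
Qed.

(** The next lemmas show that seq K injects into K when K is infinite.  Working
    with sequences instead of pairs makes sums, products and option types
    immediate afterwards.  The injection comes from a maximal pair of a set A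
    and a function that injects the sequences over A into A. *)
Section infinite_seq.
Variable K : Type.
Implicit Types (A B : set K) (f g : seq K -> K) (s t : seq K).

Let lists A s := all (mem A) s.

Let coding (p : set K * (seq K -> K)) :=
  (forall s, lists p.1 s -> p.1 (p.2 s)) /\
  (forall s t, lists p.1 s -> lists p.1 t -> p.2 s = p.2 t -> s = t).

Let ext (p q : set K * (seq K -> K)) :=
  p.1 `<=` q.1 /\ forall s, lists p.1 s -> p.2 s = q.2 s.

Let lists_sub A B s : A `<=` B -> lists A s -> lists B s.
Proof. by move=> AB; apply: sub_all => x /set_mem/AB/mem_set. Qed.

(** The bound of the empty chain is a countable set: the empty set cannot carry
    a coding, because the image of the empty sequence has to lie in it. *)
Let maximal_coding : [set: nat] #<= [set: K] ->
  exists p, coding p /\ forall q, coding q -> ext p q -> ext q p.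
Proof.
move=> /card_le_typeP[i iinj].
have [c cc] : exists c, coding (range i, c).
  pose j x := if pselect (exists n, i n = x) is left ex then projT1 (cid ex)
              else 0%N.
  have ij x : range i x -> i (j x) = x.
    rewrite /j => -[n _ <-]; case: pselect => [ex|[]]; last by exists n.
    exact: projT2 (cid ex).
  exists (fun s => i (pickle (map j s))); split=> [s _|s t].
    by exists (pickle (map j s)).
  have mK u : lists (range i) u -> map i (map j u) = u.
    elim: u => //= x u IH /andP[/set_mem /ij -> uA]; congr cons; exact: IH.
  move=> sA tA /= /iinj/(pcan_inj pickleK) st.
  by rewrite -(mK s sA) -(mK t tA) st.
pose R (p q : {p | coding p}) := `[< ext (sval p) (sval q) >].
have [||C totC|p pmax] := @ZL_preorder _ (exist coding _ cc) R.
- by move=> p; apply/asboolP; split.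
- move=> p q r /asboolP[pq1 pq2] /asboolP[qr1 qr2]; apply/asboolP; split.
    exact: subset_trans qr1.
  by move=> s sp; rewrite pq2// qr2//; exact: lists_sub sp.
- have [[p0 Cp0]|/forallNP noC] := pselect (exists p, C p); last first.
    by exists (exist coding _ cc) => p /noC.
  pose A := [set x | exists2 p, C p & (sval p).1 x].
  have fin s : lists A s -> exists2 p, C p & lists (sval p).1 s.
    elim: s => [_|x s IH /= /andP[/set_mem[p Cp px] /IH[q Cq qs]]].
      by exists p0.
    have [/asboolP[pq _]|/asboolP[qp _]] := totC _ _ Cp Cq.
      by exists q => //=; apply/andP; split=> //; exact/mem_set/pq.
    exists p => //=; apply/andP; split; first exact/mem_set.
    exact: lists_sub qs.
  pose f s := if pselect (exists2 p, C p & lists (sval p).1 s) is left ex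
              then (sval (projT1 (cid2 ex))).2 s else i 0%N.
  have fE p s : C p -> lists (sval p).1 s -> f s = (sval p).2 s.
    move=> Cp ps; rewrite /f; case: pselect => [ex|[]]; last by exists p.
    case: (cid2 ex) => q Cq qs /=.
    have [/asboolP[_]|/asboolP[_]] := totC _ _ Cp Cq; first by move=> ->.
    exact.
  have cf : coding (A, f).
    split=> [s /fin[p Cp ps]|s t /fin[p Cp ps] /fin[q Cq qt]] /=.
      rewrite (fE p)//; exists p => //.
      exact: (svalP p).1.
    rewrite (fE p)// (fE q)//.
    have [/asboolP[pq _]|/asboolP[qp _]] := totC _ _ Cp Cq.
      rewrite -(fE p)// (fE q)//; last exact: lists_sub ps.
      apply: (svalP q).2 => //; exact: lists_sub ps.
    rewrite -(fE q)// (fE p)//; last exact: lists_sub qt.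
    apply: (svalP p).2 => //; exact: lists_sub qt.
  exists (exist coding _ cf) => p Cp; apply/asboolP; split=> [x px|s ps] /=.
    by exists p.
  by rewrite (fE p).
exists (sval p); split; first exact: svalP.
by move=> q cq pq; have /asboolP := pmax (exist coding q cq) (asboolT pq).
Qed.

(** Given an injection k of C into A, sequences of length one and two over A
    represent the disjoint union of A and C. *)
Let double A (k : K -> K) x := if x \in A then [:: x] else [:: k x; k x].

(** Once A absorbs its own sequences, it also absorbs those over the larger
    set: elements become elements of A through [double], and the list of these
    elements is again a sequence over A. *)
Let coding_extends A f C (k : K -> K) : coding (A, f) ->
    (forall x, C x -> A (k x)) ->
    (forall x y, C x -> C y -> k x = k y -> x = y) ->
  (forall s, lists (A `|` C) s -> lists A (map (f \o double A k) s)) /\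
  (forall s t, lists (A `|` C) s -> lists (A `|` C) t ->
    map (f \o double A k) s = map (f \o double A k) t -> s = t).
Proof.
move=> [fA finj] kA kinj.
have dA x : (A `|` C) x -> lists A (double A k x).
  rewrite /double; case: ifPn => [xA _|/negP xA [Ax|Cx]] /=.
  - by rewrite andbT.
  - by case: xA; exact: mem_set.
  - by rewrite andbT andbb; exact/mem_set/kA.
split=> [s sAC|].
  by rewrite /lists all_map; apply: sub_all sAC => x /set_mem/dA/fA/mem_set.
elim=> [|x s IH] [|y t] //= /andP[/set_mem ACx sAC] /andP[/set_mem ACy tAC].
case=> /finj exy /IH -> //; congr cons.
have := exy (dA _ ACx) (dA _ ACy); rewrite /double.
case: ifPn => [xA|/negP xA]; case: ifPn => [yA|/negP yA] // [] // kxy.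
case: ACx => [/mem_set//|Cx]; case: ACy => [/mem_set//|Cy].
exact: kinj.
Qed.

(** In a maximal pair A has at least as many elements as its complement, and
    then the whole type embeds in seq A.  Otherwise the complement would
    contain a copy of A, and the union of A and that copy would carry a strict
    extension, with the new sequences coded in the copy. *)
Lemma card_seq_le : [set: nat] #<= [set: K] -> [set: seq K] #<= [set: K].
Proof.
move=> /maximal_coding[[A f] [cf fmax]]; have [/= fA finj] := cf.
have [] := card_le_total (~` A) A => /card_le_set_inj[h [hA hinj]].
  have [dA dinj] := coding_extends cf hA hinj.
  have lT s : lists (A `|` ~` A) s.
    by rewrite setUv /lists; elim: s => //= x s ->; rewrite in_setT.
  apply/card_le_typeP; exists (fun s => f (map (f \o double A h) s)) => s t.
  by move=> /(finj _ _ (dA _ (lT s)) (dA _ (lT t))) /dinj; apply.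
pose k y := if pselect (exists2 x, A x & h x = y) is left ex
            then projT1 (cid2 ex) else y.
have kP y : (h @` A) y -> A (k y) /\ h (k y) = y.
  rewrite /k => -[x Ax hx]; case: pselect => [ex|[]]; last by exists x.
  by case: (cid2 ex).
have [|x y /kP[_ {2}<-] /kP[_ {2}<-] ->//|dA dinj] :=
  @coding_extends A f (h @` A) k cf; first by move=> x /kP[].
pose g s := if lists A s then f s else h (f (map (f \o double A k) s)).
have cg : coding (A `|` h @` A, g).
  split=> [s sAC|s t sAC tAC] /=; rewrite /g.
    case: ifP => [sA|_]; first by left; exact: fA.
    by right; exists (f (map (f \o double A k) s)) => //; exact/fA/dA.
  have fdA u : lists (A `|` h @` A) u -> A (f (map (f \o double A k) u)).
    by move=> /dA/fA.
  case: ifP => sA; case: ifP => tA.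
  - exact: finj.
  - by move=> e; have /hA[] := fdA _ tAC; rewrite -e; exact: fA.
  - by move=> e; have /hA[] := fdA _ sAC; rewrite e; exact: fA.
  - move=> /(hinj _ _ (fdA _ sAC) (fdA _ tAC)).
    by move=> /(finj _ _ (dA _ sAC) (dA _ tAC)); exact: dinj.
have [|BA _] := fmax _ cg.
  by split=> [x Ax|s sA] /=; [left|rewrite /g sA].
have Af := fA [::] isT.
by case: (hA _ Af); apply: BA; right; exists (f [::]).
Qed.

End infinite_seq.

Lemma card_option_le (K : Type) : [set: nat] #<= [set: K] ->
  [set: option K] #<= [set: K].
Proof.
move=> /card_seq_le; apply: card_le_trans; apply/card_le_typeP.
by exists (fun o => if o is Some x then [:: x] else [::]) => -[x|] [y|] // [->].
Qed.

Lemma card_prod_le (K L M : Type) : [set: nat] #<= [set: M] ->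
  [set: K] #<= [set: M] -> [set: L] #<= [set: M] -> [set: K * L] #<= [set: M].
Proof.
move=> /card_seq_le + /card_le_typeP[f finj] /card_le_typeP[g ginj].
apply: card_le_trans; apply/card_le_typeP.
by exists (fun p => [:: f p.1; g p.2]) => -[x y] [x' y'] [/finj -> /ginj ->].
Qed.

Lemma card_fun_le (K L M N : Type) : K ->
  [set: K] #<= [set: M] -> [set: L] #<= [set: N] ->
  [set: K -> L] #<= [set: M -> N].
Proof.
move=> k0 /card_le_typeP[f finj] /card_le_typeP[g ginj]; apply/card_le_typeP.
have /choice[r rP] : forall m, exists k, forall k', f k' = m -> k' = k.
  move=> m; have [[k km]|nk] := pselect (exists k, f k = m).
    by exists k => k' k'm; apply: finj; rewrite k'm.
  by exists k0 => k' k'm; case: nk; exists k'.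
exists (fun u m => g (u (r m))) => u v uv; apply/funext => k.
have -> : k = r (f k) by exact: rP.
by apply: ginj; exact: (congr1 (@^~ (f k)) uv).
Qed.

(** The default value x0 makes an enumeration possible when A is empty. *)
Lemma card_le_enum (T K : Type) (A : set T) (x0 : T) : A #<= [set: K] ->
  exists f : K -> T,
    A `<=` range f /\ forall k, A (f k) \/ f k = x0.
Proof.
rewrite -(card_le_eql (card_setT A)) => /card_le_typeP[g ginj].
have /choice[f fP] : forall k, exists x, (forall a, g a = k -> val a = x) /\
    (A x \/ x = x0).
  move=> k; have [[a ak]|na] := pselect (exists a, g a = k).
    exists (val a); split; last by left; exact/set_mem/valP.
    by move=> b bk; congr val; apply: ginj; rewrite bk.
  by exists x0; split; [move=> a ak; case: na; exists a|right].
exists f; split=> [x Ax|k]; last by have [] := fP k.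
exists (g (SigSub (mem_set Ax))) => //.
by have [/(_ _ erefl)] := fP (g (SigSub (mem_set Ax))).
Qed.

(** * Closing off under infinitary operations *)

Section closing_off.
Context {X E Q : Type}.

Inductive term := Start | Apply of Q & (E -> term).

(** The tree structure of a term is recorded without well-foundedness, as a
    function on finite paths; [None] stands for the paths that reach or pass a
    leaf. *)
Fixpoint label (t : term) (s : seq E) : option Q :=
  match t, s with
  | Start, _ => None
  | Apply q _, [::] => Some q
  | Apply _ c, e :: s' => label (c e) s'
  end.

Lemma label_inj : injective label.
Proof.
elim=> [|q c IH] [|r d] // e; try by have := congr1 (@^~ [::]) e.
have [-> cd] : q = r /\ c = d; last by rewrite cd.
split; first by have [] := congr1 (@^~ [::]) e.
apply/funext => i; apply: IH; apply/funext => s.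
exact: (congr1 (@^~ (i :: s)) e).
Qed.

(** The closure is obtained as the set of values of all terms, which replaces a
    recursion along the successor cardinal of the arity: an operation applied to
    values of terms is the value of a term. *)
Lemma closing_off (x0 : X) (F : Q -> (E -> X) -> X) : exists A : set X,
  [/\ A x0, forall q c, (forall e, A (c e)) -> A (F q c) &
      A #<= [set: seq E -> option Q]].
Proof.
pose fix eval t := if t is Apply q c then F q (eval \o c) else x0.
exists (range eval); split; first by exists Start.
- move=> q c /(_ _)/cid2 ev.
  exists (Apply q (fun e => projT1 (ev e))) => //=; congr F.
  by apply/funext => e /=; case: (ev e).
- apply: card_le_trans (card_image_le _ _) _; apply/card_le_typeP.
  by exists label; exact: label_inj.
Qed.

End closing_off.

(** After uncurrying, the exponent is a product of D * D and of its finite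
    sequences, which has the size of D. *)
Lemma card_closing_off (D P : Type) :
  [set: nat] #<= [set: D] -> [set: nat] #<= [set: P] ->
  [set: seq (D * D) -> option (D * D -> option P)] #<= [set: D -> P].
Proof.
move=> iD iP; have /card_le_typeP[i _] := iD.
have DD : [set: D * D] #<= [set: D] by exact: card_prod_le.
apply: (@card_le_trans _ _ _ [set: seq (D * D) * (D * D) -> option (option P)]).
  apply/card_le_typeP.
  exists (fun f p => if f p.1 is Some g then Some (g p.2) else None) => f g fg.
  apply/funext => s; have {}fg d := congr1 (@^~ (s, d)) fg.
  case: (f s) (g s) fg => [u|] [v|] //= uv; last 2 first.
  - by have := uv (i 0%N, i 0%N).
  - by have := uv (i 0%N, i 0%N).
  by congr Some; apply/funext => d; have [] := uv d.
apply: card_fun_le.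
- exact: ([::], (i 0%N, i 0%N)).
- apply: card_prod_le => //; apply: card_le_trans (card_seq_le iD).
  have /card_le_typeP[j jinj] := DD; apply/card_le_typeP.
  by exists (map j); exact: inj_map.
- apply: card_le_trans (card_option_le iP); apply: card_option_le.
  apply: card_le_trans iP _; apply/card_le_typeP.
  by exists Some => x y [].
Qed.

(** * Cardinal functions of Urysohn spaces *)

Section spaces.
Variable X : topologicalType.

Lemma card_natD_le (K L : Type) : [set: K] #<= [set: L] ->
  [set: K] #<= [set: nat + L].
Proof.
move=> /card_le_trans; apply; apply/card_le_typeP.
by exists inr => x y [].
Qed.

Lemma local_pi_base_card (x : X) :
  exists2 B, local_pi_base x B & B #<= [set: pi_character X].
Proof.
have [[B xB BK] _] := local_pi_characterP x; exists B => //.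
rewrite (card_le_eql BK); apply: card_natD_le.
exact: (card_supP (@local_pi_character X)).1.
Qed.

Lemma theta_pseudocharacter_card (hX : urysohn_space X) (x : X) :
  exists Us : set (set X), [/\ forall U, Us U -> open U /\ U x,
    Us #<= [set: theta_pseudocharacter X] &
    [set x] = \bigcap_(U in Us) theta_closure (closure U)].
Proof.
have [[Us [Uo UK xU]] _] := local_theta_pseudocharacterP x hX.
exists Us; split=> //; apply: card_le_trans UK _; apply: card_natD_le.
exact: (card_supP (@local_theta_pseudocharacter X)).1.
Qed.

Lemma urysohn_cellular_card (V : set (set X)) : urysohn_cellular V ->
  V #<= [set: urysohn_cellularity X].
Proof.
move=> cV; rewrite -(card_le_eql (card_setT V)); apply: card_natD_le.
exact: (card_supP (fun V : {V | urysohn_cellular V} => set_type (sval V))).1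
  (exist _ V cV).
Qed.

(** Maximality only compares V with members of the local pi-bases at points of
    A.  This suffices at a point a of A outside the theta-closure of the closure
    of U: inside any neighborhood of a there is an O in B a whose closure
    misses that of U, and O either belongs to V or has a closure meeting that
    of some member of V. *)
Lemma urysohn_cellular_theta_cover (A : set X) (B : X -> set (set X))
    (U : set X) :
    (forall x, local_pi_base x (B x)) ->
  exists V : set (set X), [/\ urysohn_cellular V,
    V `<=` \bigcup_(a in A) B a,
    forall O, V O -> closure O `&` closure U = set0 &
    A `\` theta_closure (closure U) `<=`
      theta_closure (\bigcup_(O in V) closure O)].
Proof.
move=> Bpi.
pose C := [set O | (\bigcup_(a in A) B a) O /\ closure O `&` closure U = set0].
have [V [VC Vtriv Vmax]] := ex_maximal_disjoint_subcollection closure C.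
exists V; split=> [|O /VC[]//|O /VC[]//|].
  split=> [O /VC[[a Aa BaO] _]|O1 O2 VO1 VO2 O12]; first exact: (Bpi a).1.
  apply: contrapT => /eqP/set0P O1O2; apply: O12.
  exact: Vtriv.
move=> a [Aa /existsNP[G]].
move=> /not_implyP[oG /not_implyP[Ga /set0P/negP/negPn/eqP GU]] H oH Ha.
(* G isolates O from U; H is the neighborhood of a that has to be tested. *)
have [O BaO OHG] : exists2 O, B a O & O `<=` H `&` G.
  by apply: (Bpi a).2; apply: open_nbhs_nbhs; split=> //; exact: openI.
have [oO [o Oo]] := (Bpi a).1 _ BaO.
have clOH : closure O `<=` closure H.
  by apply: closure_subset => z /OHG[].
have CO : C O.
  split; first by exists a.
  rewrite -subset0 -GU; apply: setSI; apply: closure_subset => z /OHG[] //.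
have [VO|nVO] := pselect (V O).
  exists o; split; first exact/clOH/subset_closure.
  by exists O => //; exact: subset_closure.
apply: contrapT => noH; apply: (Vmax (V `|` [set O])).
- by split=> [|VOV]; [exact: subsetUl|apply: nVO; apply: VOV; right].
- by move=> _ [/VC//|->].
have VO' O' : V O' -> closure O' `&` closure O !=set0 -> O' = O.
  move=> VO' [z [O'z Oz]]; case: noH; exists z; split; first exact: clOH.
  by exists O'.
move=> O1 O2 [V1|->] [V2|->] O12 //; first exact: Vtriv.
- exact: VO'.
- by apply/esym/VO' => //; rewrite setIC.
Qed.

End spaces.

Theorem theorem2p1 (X : topologicalType) (hX : urysohn_space X) :
  [set: X] #<=
  [set: urysohn_cellularity X * theta_pseudocharacter X -> pi_character X].
Proof.
have [[x0 _]|nX] := pselect (exists x : X, True); last first.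
  apply/card_le_typeP.
  exists (fun x => False_rect _ (nX (ex_intro _ x I))) => x.
  by case: nX; exists x.
set D := (urysohn_cellularity X * theta_pseudocharacter X)%type.
set P := pi_character X.
have iP : [set: nat] #<= [set: P].
  by apply/card_le_typeP; exists inl => m n [].
have iD : [set: nat] #<= [set: D].
  by apply/card_le_typeP; exists (fun n => (inl n, inl 0%N)) => m n [].
have psiD : [set: theta_pseudocharacter X] #<= [set: D].
  by apply/card_le_typeP; exists (pair (inl 0%N)) => u v [].
have UcD : [set: urysohn_cellularity X] #<= [set: D].
  by apply/card_le_typeP; exists (fun u => (u, inl 0%N)) => u v [].
have /choice[B Bpi] : forall x : X, exists B,
    local_pi_base x B /\ B #<= [set: P].
  by move=> x; have [B xB BP] := local_pi_base_card x; exists B.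
have /choice[b bP] : forall x, exists b : P -> set X, B x `<=` range b.
  move=> x; have [b [bB _]] := card_le_enum set0 (Bpi x).2.
  by exists b.
(* The empty piece, available at every point, pads the enumerations of the
   families V U, which may be empty. *)
pose piece x (o : option P) := if o is Some p then b x p else set0.
have /choice[pick pickP] : forall S : set X, exists x, S <> setT -> ~ S x.
  move=> S; have [->|/eqP/setTPn[x Sx]] := pselect (S = setT).
    by exists x0.
  by exists x.
pose cover (l : D * D -> option P) (c : D * D -> X) :=
  \bigcup_d theta_closure (\bigcup_e closure (piece (c (d, e)) (l (d, e)))).
have [A [Ax0 Aclosed AK]] := closing_off x0 (fun l c => pick (cover l c)).
suff -> : [set: X] = A.
  exact: card_le_trans AK (card_closing_off iD iP).
apply/seteqP; split=> // q _; apply: contrapT => nAq.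
suff [l [c [Ac Acover ncover]]] : exists l c, [/\ forall i, A (c i),
    A `<=` cover l c & ~ cover l c q].
  apply: (pickP (cover l c)); last exact/Acover/Aclosed.
  by move=> coverT; apply: ncover; rewrite coverT.
have [Us [Uo UK qU]] := theta_pseudocharacter_card hX q.
have sep a : A a -> exists2 U, Us U & ~ theta_closure (closure U) a.
  move=> Aa; apply: contrapT => nU; apply: nAq.
  suff -> : q = a by [].
  suff : [set q] a by move=> ->.
  rewrite qU => U UsU; apply: contrapT => Ua; apply: nU; by exists U.
(* As A is nonempty, so is Us, and it can be enumerated by D exactly. *)
have [U0 UsU0 _] := sep _ Ax0.
have [u [uUs Usu]] := card_le_enum U0 (card_le_trans UK psiD).
have {}Usu d : Us (u d) by have [|->] := Usu d.
have Blocal x : local_pi_base x (B x) by exact: (Bpi x).1.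
have /choice[V VP] := fun U => urysohn_cellular_theta_cover A U Blocal.
have /choice[v vP] : forall U, exists v : D -> set X,
    V U `<=` range v /\ forall d, V U (v d) \/ v d = set0.
  move=> U; apply: card_le_enum; have [cV _ _ _] := VP U.
  exact: card_le_trans (urysohn_cellular_card cV) UcD.
have /choice[f fP] : forall i : D * D, exists lc : option P * X,
    A lc.2 /\ piece lc.2 lc.1 = v (u i.1) i.2.
  move=> [d e] /=; have [/= + /(_ e)[VO|->]] := vP (u d); last first.
    by move=> _; exists (None, x0).
  have [_ /(_ _ VO)[a Aa /bP[p _ bp]] _ _ _] := VP (u d).
  by exists (Some p, a).
have coverE : cover (fst \o f) (snd \o f) =
    \bigcup_d theta_closure (\bigcup_e closure (v (u d) e)).
  apply: eq_bigcupr => d _; congr theta_closure; apply: eq_bigcupr => e _ /=.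
  by rewrite (fP (d, e)).2.
exists (fst \o f), (snd \o f); rewrite coverE; split=> [i|a Aa|].
- exact: (fP i).1.
- have [U /uUs[d _ <-] aU] := sep a Aa; exists d => //.
  have [_ _ _ /(_ a (conj Aa aU))] := VP (u d).
  move=> aV G oG Ga; have [z [Gz [O VO Oz]]] := aV G oG Ga.
  exists z; split=> //; have [/(_ _ VO)[e _ veO] _] := vP (u d).
  by exists e => //; rewrite veO.
- move=> [d _ /(_ (u d))]; have [ou uq] := Uo _ (Usu d).
  move=> /(_ ou uq)[z [uz [e _ vz]]].
  have [_ /(_ e)[VO|v0]] := vP (u d); last by rewrite v0 closure0 in vz.
  have [_ _ /(_ _ VO) vu0 _] := VP (u d).
  by suff : set0 z by []; rewrite -vu0.
Qed.
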